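(* Let $s,t$ be integers and $p$ a prime such that $s=p^as'$ and $t=p^bt'$, where $s',t'$ are integers with $p\nmid s't'$, $a$ is a positive integer, and $b$ is a positive integer or $b=\infty$ (where $b=\infty$ means $t=0$), with $b\ge 2a$. Then for all $n\ge 2$, \[ v_p(P_n)=\begin{cases}\varphi(n)\,a & \text{if } b>2a,\\ \varphi(n)\,a+v_p(P'_n) & \text{if } b=2a,\end{cases} \] where $(P_n)_{n\ge1}$ is the sequence of Lucas atoms associated with $(s,t)$ and $(P'_n)_{n\ge 1}$ is the sequence of Lucas atoms associated with $(s',t')$, i.e. with the Lucas sequence having characteristic polynomial $X^2-s'X-t'$.
   Context: Lucas atoms: for $n\ge 1$ let $\Phi_n(\alpha,\beta)=\prod_{1\le j\le n,\ \gcd(j,n)=1}(\alpha-\omega^j\beta)$, with $\omega$ a primitive $n$-th root of unity (the homogenization of the $n$-th cyclotomic polynomial). Put $P_1(s,t)=1$, and for $n\ge 2$ let $P_n(s,t)\in\mathbb Z[s,t]$ be the unique polynomial with $P_n(\alpha+\beta,-\alpha\beta)=\Phi_n(\alpha,\beta)$ as polynomials in the variables $\alpha,\beta$. For integers $s,t$, the sequence of Lucas atoms associated with $(s,t)$ is the sequence of integer values $P_n=P_n(s,t)$; thus $P'_n=P_n(s',t')$. $v_p$ is the $p$-adic valuation, with $v_p(0)=+\infty$; $\varphi$ is Euler's totient function. *)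

(* Defs.v *)
From mathcomp Require Import all_boot all_order all_fingroup all_algebra all_field.
From mathcomp Require constructive_ereal mpoly.

Set Implicit Arguments.
Unset Strict Implicit.
Unset Printing Implicit Defensive.

(* The notations of mpoly and of constructive_ereal cannot be active at the
   same time, so mpoly is imported only inside this module. *)
Module LucasAtom.

Import mpoly.
Import GRing.Theory Num.Theory.
Local Open Scope ring_scope.

Notation x0 := ('X_(@Ordinal 2 0 isT)).
Notation x1 := ('X_(@Ordinal 2 1 isT)).

Definition homCyclotomic (w : algC) (n : nat) : {mpoly algC[2]} :=
  \prod_(1 <= j < n.+1 | coprime j n) (x0 - w ^+ j *: x1).

(* Here x0, x1 stand for alpha, beta on the right-hand side; P is a polynomial
   in s, t, for which alpha + beta and - alpha beta are substituted. *)
Definition is_atom (n : nat) (P : {mpoly int[2]}) : Prop :=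
  forall w : algC, n.-primitive_root w ->
    map_mpoly intr P \mPo [tuple x0 + x1; - (x0 * x1)] = homCyclotomic w n.

Section Homogenization.
Variable R : comNzRingType.

(* homogenization of p as a form of degree m, for size p <= m.+1 *)
Definition homogenize (m : nat) (p : {poly R}) : {mpoly R[2]} :=
  \sum_(i < m.+1) p`_i *: (x0 ^+ i * x1 ^+ (m - i)).

Lemma homogMXsubC m (p : {poly R}) c : (size p <= m.+1)%N ->
  homogenize m.+1 (p * ('X - c%:P)) = homogenize m p * (x0 - c *: x1).
Proof.
move=> sp; rewrite /homogenize !mulrBr !mulr_suml.
under eq_bigr do rewrite coefB coefMX coefMC scalerBl.
rewrite sumrB big_ord_recl /= scale0r add0r; congr (_ - _).
  apply: eq_bigr => i _; rewrite /= /bump /= add1n subSS -scalerAl exprS.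
 by rewrite add0n -mulrA mulrC.
rewrite [LHS]big_ord_recr /= nth_default // mul0r scale0r addr0.
apply: eq_bigr => i _; rewrite -scalerAr -scalerAl scalerA mulrC.
by rewrite subSn -1?ltnS // exprSr mulrA.
Qed.

Lemma homog_prod (r : seq R) :
  homogenize (size r) (\prod_(c <- r) ('X - c%:P)) = \prod_(c <- r) (x0 - c *: x1).
Proof.
elim: r => [|c r IH] /=.
  rewrite !big_nil /homogenize big_ord_recl big_ord0 addr0 subnn !expr0 mulr1.
  by rewrite coef1 scale1r.
by rewrite !big_cons mulrC homogMXsubC ?IH ?size_prod_XsubC // mulrC.
Qed.

End Homogenization.

Lemma homCyclotomicE n w : (1 < n)%N -> n.-primitive_root w ->
  map_mpoly intr (homogenize (totient n) 'Phi_n) = homCyclotomic w n.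
Proof.
move=> n1 pw; have n0 := ltnW n1.
pose r := [seq w ^+ j | j <- index_iota 0 n & coprime j n].
have Phi_r : map_poly intr 'Phi_n = \prod_(c <- r) ('X - c%:P) :> {poly algC}.
  by rewrite (Cintr_Cyclotomic pw) /cyclotomic big_map big_filter big_mkord.
have sr : size r = totient n.
  apply: succn_inj; rewrite -size_Cyclotomic -(size_prod_XsubC r id) -Phi_r.
  by rewrite size_map_inj_poly //; exact: intr_inj.
have -> : homCyclotomic w n = \prod_(c <- r) (x0 - c *: x1).
  rewrite big_map big_filter /homCyclotomic big_mkcond big_nat_recr //=.
  rewrite -big_mkcond [RHS]big_ltn_cond // /coprime gcd0n gcdnn gtn_eqF //=.
  by rewrite mulr1.
rewrite -homog_prod -Phi_r sr /homogenize rmorph_sum.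
apply: eq_bigr => i _; rewrite /= map_mpolyZ coef_map.
by rewrite rmorphM !rmorphXn /= !map_mpolyX.
Qed.

Lemma homCyclotomic_swap n w : (1 < n)%N -> n.-primitive_root w ->
  \prod_(1 <= j < n.+1 | coprime j n) (x1 - w ^+ j *: x0) = homCyclotomic w n.
Proof.
move=> n1 pw; have n0 := ltnW n1.
pose c := \prod_(1 <= j < n | coprime j n) - w ^+ (n - j).
have cut (R : comNzRingType) (F : nat -> R) :
    \prod_(1 <= j < n.+1 | coprime j n) F j =
    \prod_(1 <= j < n | coprime j n) F j.
  by rewrite big_mkcond big_nat_recr //= -big_mkcond /coprime gcdnn gtn_eqF ?mulr1.
have swapE : \prod_(1 <= j < n.+1 | coprime j n) (x1 - w ^+ j *: x0) =
    c%:MP * homCyclotomic w n.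
  rewrite /homCyclotomic !cut rmorph_prod -big_split /= big_nat_rev /=.
  rewrite big_seq_cond [RHS]big_seq_cond; apply: eq_big => j.
    rewrite mem_index_iota; case: (boolP (_ < _ < _)%N) => //= /andP[_ jn].
    rewrite add1n subSS /coprime -{2 3}(subnK (ltnW jn)).
    by rewrite gcdnDl gcdnDr gcdnC.
  rewrite mem_index_iota => /andP[/andP[_ jn] _].
  rewrite add1n subSS mul_mpolyC scaleNr scalerBr scalerA -exprD subnK 1?ltnW //.
  by rewrite (prim_expr_order pw) scale1r opprB.
suff c1 : c = 1 by rewrite swapE c1 mul1r.
have e_lin j (i k : 'I_2) :
    ('X_i - w ^+ j *: 'X_k : {mpoly algC[2]}).@[fun=> 1] = 1 - w ^+ j.
  by rewrite mevalB mevalZ !mevalXU mulr1.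
have := congr1 (meval (fun=> 1)) swapE; rewrite mevalM mevalC /homCyclotomic !rmorph_prod /=.
rewrite !cut; under eq_bigr do rewrite e_lin.
under [X in _ = _ * X]eq_bigr do rewrite e_lin.
set d := \prod_(_ <= _ < _ | _) _; move=> dE.
have d0 : d != 0.
  rewrite prodf_seq_neq0; apply/allP => j; rewrite mem_index_iota => /andP[j0 jn].
  apply/implyP => _; rewrite subr_eq0 eq_sym -(prim_order_dvd pw).
  by rewrite gtnNdvd.
by apply: (mulIf d0); rewrite mul1r -dE.
Qed.

Lemma homCyclotomic_sym n w : (1 < n)%N -> n.-primitive_root w ->
  homCyclotomic w n \is symmetric.
Proof.
move=> n1 pw; apply/issymP => s.
have symX i : msym s 'X_i = 'X_(s i) :> {mpoly algC[2]}.
  by rewrite /msym mmapX mmap1U.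
rewrite {1}/homCyclotomic rmorph_prod /=.
under eq_bigr do rewrite msymB msymZ !symX.
have /eqP ns : s (Ordinal (isT : 0 < 2)%N) != s (Ordinal (isT : 1 < 2)%N).
  by rewrite (inj_eq perm_inj).
case: (s _) ns => -[|[|//]] h; case: (s _) => -[|[|//]] k ns.
- by case: ns; apply: val_inj.
- by rewrite (bool_irrelevance h isT) (bool_irrelevance k isT).
- rewrite -(homCyclotomic_swap n1 pw).
  by rewrite (bool_irrelevance h isT) (bool_irrelevance k isT).
- by case: ns; apply: val_inj.
Qed.

Lemma map_mpoly_intr_inj : injective (map_mpoly intr : {mpoly int[2]} -> {mpoly algC[2]}).
Proof.
move=> p q /mpolyP pq; apply/mpolyP => m.
by have := pq m; rewrite !mcoeff_map_mpoly => /intr_inj.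
Qed.

Lemma comp_mpolyA (R : comNzRingType) (p : {mpoly R[2]}) (A B : 2.-tuple {mpoly R[2]}) :
  (p \mPo A) \mPo B = p \mPo [tuple tnth A i \mPo B | i < 2].
Proof.
rewrite [p \mPo A]comp_mpolyEX [RHS]comp_mpolyEX raddf_sum /=.
apply: eq_bigr => m _; rewrite comp_mpolyZ !comp_mpolyX rmorph_prod.
by congr (_ *: _); apply: eq_bigr => i _; rewrite rmorphXn tnth_mktuple.
Qed.

Lemma tuple2P (T : Type) (u v : 2.-tuple T) :
  tnth u (Ordinal (isT : 0 < 2)%N) = tnth v (Ordinal (isT : 0 < 2)%N) ->
  tnth u (Ordinal (isT : 1 < 2)%N) = tnth v (Ordinal (isT : 1 < 2)%N) -> u = v.
Proof.
move=> h0 h1; apply: eq_from_tnth => -[[|[|//]] k].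
  by rewrite (_ : Ordinal k = Ordinal (isT : 0 < 2)%N) //; apply: val_inj.
by rewrite (_ : Ordinal k = Ordinal (isT : 1 < 2)%N) //; apply: val_inj.
Qed.

Notation negT := [tuple x0; - x1].
Notation vieta := [tuple x0 + x1; - (x0 * x1)].

Section Vieta.
Variable R : comNzRingType.
Implicit Type p : {mpoly R[2]}.

Lemma comp_negK p : (p \mPo negT) \mPo negT = p.
Proof.
rewrite comp_mpolyA -[RHS]comp_mpoly_id; congr (_ \mPo _).
by apply: tuple2P; rewrite !tnth_mktuple /tnth /= ?comp_mpolyN !comp_mpolyXU //= opprK.
Qed.

Lemma mesym_vieta p :
  (p \mPo negT) \mPo vieta = p \mPo [tuple mesym 2 R i.+1 | i < 2].
Proof.
rewrite comp_mpolyA; congr (_ \mPo _); apply: tuple2P; rewrite !tnth_mktuple /=.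
  rewrite mesym1E !big_ord_recl big_ord0 addr0 /tnth /= comp_mpolyXU /=.
  by congr ('X_ _ + 'X_ _); apply: val_inj.
rewrite mesymnnE !big_ord_recl big_ord0 mulr1 /tnth /= comp_mpolyN comp_mpolyXU /= opprK.
by congr ('X_ _ * 'X_ _); apply: val_inj.
Qed.

End Vieta.

Lemma map_vieta (p : {mpoly int[2]}) :
  map_mpoly intr p \mPo vieta = map_mpoly intr (p \mPo vieta) :> {mpoly algC[2]}.
Proof.
rewrite map_mpoly_comp; last exact: intr_inj.
congr (_ \mPo _); apply: val_inj => /=.
by rewrite rmorphD rmorphN rmorphM /= !map_mpolyX.
Qed.

Lemma atom_exists n : (1 < n)%N -> {P : {mpoly int[2]} | is_atom n P}.
Proof.
move=> n1; pose H := homogenize (totient n) 'Phi_n.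
have [w pw] := C_prim_root_exists (ltnW n1).
have symH : H \is symmetric.
  apply/issymP => s; apply: map_mpoly_intr_inj.
  have /issymP/(_ s) := homCyclotomic_sym n1 pw.
  rewrite -(homCyclotomicE n1 pw) -/H => <-.
  by apply/mpolyP => m; rewrite mcoeff_sym !mcoeff_map_mpoly mcoeff_sym.
have [t [tH _]] := sym_fundamental symH.
exists (t \mPo negT) => z pz; rewrite map_vieta mesym_vieta tH.
exact: homCyclotomicE.
Qed.

Lemma atom_unique n P Q : (0 < n)%N -> is_atom n P -> is_atom n Q -> P = Q.
Proof.
move=> n0 aP aQ; have [w pw] := C_prim_root_exists n0.
have := etrans (aP w pw) (esym (aQ w pw)).
rewrite !map_vieta => /map_mpoly_intr_inj PQ.
rewrite -(comp_negK P) -(comp_negK Q); congr (_ \mPo _).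
apply: msym_fundamental_un; rewrite -!mesym_vieta.
by rewrite (comp_negK P) (comp_negK Q).
Qed.

(* The atom of index 1 is 1 by convention: x0 - x1 is not symmetric.
   The value at n = 0 is a dummy. *)
Definition atom (n : nat) : {mpoly int[2]} :=
  if (1 < n)%N =P true is ReflectT n1 then sval (atom_exists n1) else 1.

Lemma atomP n : (1 < n)%N -> is_atom n (atom n).
Proof. by move=> n1; rewrite /atom; case: eqP => // n1'; exact: svalP. Qed.

Lemma atom1 : atom 1 = 1.
Proof. by rewrite /atom; case: eqP. Qed.

Definition atom_value (n : nat) (s t : int) : int :=
  (atom n).@[tnth [tuple s; t]].

End LucasAtom.

Import constructive_ereal.
Import Order.TTheory GRing.Theory Num.Theory.
Local Open Scope ring_scope.
Local Open Scope ereal_scope.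

Notation lucas_atom := LucasAtom.atom_value.

Definition valuation (p : nat) (x : int) : \bar int :=
  if x == 0%R then +oo else (logn p `|x|)%:Z%:E.

(* p ^ b for an extended exponent 0 <= b <= +oo, with p ^ +oo = 0;
   negative exponents are not used. *)
Definition epow (p : nat) (b : \bar int) : int :=
  if b is k%:E then (p%:Z ^+ `|k|%N)%R else 0%R.

(* Main.v *)
(** [P_n] is weighted homogeneous of degree [phi(n)] for the weights 1 of [s] and 2 of [t]:
    scaling [s] by [c] and [t] by [c^2] amounts to scaling [alpha] and [beta] by [c].
    With [c = p^a] this settles the case [b = 2a], and for [b > 2a] it leaves
    [P_n(s', p^(b-2a) t')], which is congruent modulo [p] to
    [P_n(s', 0) = Phi_n(s', 0) = s'^phi(n)], a unit modulo [p]. *)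
Require Import Defs.
From mathcomp Require Import all_boot all_order all_algebra.
From mathcomp Require all_field mpoly ring.

Module AtomValue.

Import all_field mpoly ring.
Import Order.TTheory GRing.Theory Num.Theory.
Import LucasAtom.
Local Open Scope ring_scope.

Lemma prod_coprime_const (R : comNzRingType) (c : R) n :
  (1 < n)%N -> \prod_(1 <= j < n.+1 | coprime j n) c = c ^+ totient n.
Proof.
move=> n1; have n0 := ltnW n1.
(* As [n > 1], neither 0 nor [n] is coprime to [n], so the range 1..n can be traded for 0..n-1, over
   which [totient_count_coprime] counts. *)
have cut : \prod_(1 <= j < n.+1 | coprime j n) c = \prod_(0 <= j < n | coprime j n) c.
  rewrite [RHS]big_ltn_cond // {2}/coprime gcd0n gtn_eqF //.
  by rewrite big_mkcond big_nat_recr //= -big_mkcond /coprime gcdnn gtn_eqF ?mulr1.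
rewrite cut totient_count_coprime big_const_seq iter_mulr_1; congr (_ ^+ _).
rewrite -sum1_count [LHS]big_mkcond; apply: eq_bigr => j _.
by rewrite coprime_sym; case: coprime.
Qed.

Lemma meval_intr (R : comNzRingType) k (P : {mpoly int[k]}) (u : 'I_k -> int) (v : 'I_k -> R) :
  (forall i, v i = (u i)%:~R) -> (map_mpoly intr P).@[v] = P.@[u]%:~R.
Proof.
move=> vu; rewrite {1}(mpolyE P) (raddf_sum (map_mpoly intr)) (raddf_sum (meval v)).
rewrite [in RHS]mevalE rmorph_sum; apply: eq_bigr => m _ /=.
rewrite map_mpolyZ mevalZ map_mpolyX mevalX rmorphM rmorph_prod /=.
by congr (_ * _); apply: eq_bigr => i _; rewrite vu rmorphXn.
Qed.

Lemma meval_congr k (d : int) (P : {mpoly int[k]}) (u v : 'I_k -> int) :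
  (forall i, u i = v i %[mod d])%Z -> (P.@[u] = P.@[v] %[mod d])%Z.
Proof.
move=> uv; rewrite !mevalE.
have modM x x' y y' : (x = x' %[mod d] -> y = y' %[mod d] -> x * y = x' * y' %[mod d])%Z.
  by move=> xx yy; rewrite -[LHS]modzMm xx yy modzMm.
apply: (big_ind2 (fun x y => x = y %[mod d])%Z) => [//|x x' y y' xx yy|m _].
  by rewrite -[LHS]modzDm xx yy modzDm.
apply: (modM) => //.
apply: (big_ind2 (fun x y => x = y %[mod d])%Z) => [//|x x' y y'|i _]; first exact: modM.
by rewrite -[LHS]modzXm uv modzXm.
Qed.

(** Evaluating the identity [is_atom] at a point gives access to the integer value through its
    linear factors over [algC], for any [alpha], [beta] with the right sum and product. *)
Lemma atom_value_Vieta n (w : algC) (s t : int) (alpha beta : algC) :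
  (1 < n)%N -> n.-primitive_root w ->
  s%:~R = alpha + beta -> t%:~R = - (alpha * beta) ->
  (atom_value n s t)%:~R = \prod_(1 <= j < n.+1 | coprime j n) (alpha - w ^+ j * beta).
Proof.
move=> n1 pw sE tE.
pose v (i : 'I_2) := if i == 0 :> nat then alpha else beta.
have := congr1 (meval v) (atomP n1 pw).
rewrite comp_mpoly_meval (meval_intr _ _ _ (tnth [tuple s; t])) => [->|].
  rewrite rmorph_prod; apply: eq_bigr => j _.
  by rewrite /= mevalB mevalZ !mevalXU.
case=> -[|[|//]] i /=; rewrite !(tnth_nth 0) /= ?mevalD ?mevalN ?mevalM !mevalXU /v /=.
  by rewrite sE.
by rewrite tE.
Qed.

Lemma sum_prod_roots (s t : algC) : exists alpha beta : algC, s = alpha + beta /\ t = - (alpha * beta).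
Proof.
(* The quadratic formula for X^2 - sX - t, with [d] a square root of the discriminant. *)
pose d := sqrtC (s ^+ 2 + 4 * t); have dE : d ^+ 2 = s ^+ 2 + 4 * t by rewrite sqrtCK.
exists ((s + d) / 2), ((s - d) / 2); split; first by field.
(* Eliminating [t] in favour of [d] leaves an identity in the free variables [s] and [d]. *)
have -> : t = (d ^+ 2 - s ^+ 2) / 4 by rewrite dE; field.
by field.
Qed.

(** Each of the phi(n) linear factors gains one [c] when both roots are multiplied by [c]. *)
Lemma atom_value_scale n (c s t : int) : (1 < n)%N ->
  atom_value n (c * s) (c ^+ 2 * t) = c ^+ totient n * atom_value n s t.
Proof.
move=> n1; have [w pw] := C_prim_root_exists (ltnW n1).
have [x [y [sE tE]]] := sum_prod_roots s%:~R t%:~R.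
apply: (@intr_inj algC).
rewrite rmorphM rmorphXn /= (atom_value_Vieta n w s t x y) //.
rewrite (atom_value_Vieta n w _ _ (c%:~R * x) (c%:~R * y)) //.
- rewrite -prod_coprime_const // -big_split; apply: eq_bigr => j _ /=; ring.
- by rewrite rmorphM /= sE; ring.
by rewrite rmorphM rmorphXn /= tE; ring.
Qed.

(** The roots can be taken to be [s] and 0, so every linear factor equals [s]. *)
Lemma atom_value_s0 n (s : int) : (1 < n)%N -> atom_value n s 0 = s ^+ totient n.
Proof.
move=> n1; have [w pw] := C_prim_root_exists (ltnW n1).
apply: (@intr_inj algC); rewrite rmorphXn /= (atom_value_Vieta _ w _ _ s%:~R 0) //.
- by rewrite -prod_coprime_const //; apply: eq_bigr => j _; rewrite mulr0 subr0.
- by rewrite addr0.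
by rewrite mulr0 oppr0.
Qed.

Lemma atom_value_congr n (d s t s' t' : int) :
  (s = s' %[mod d] -> t = t' %[mod d] ->
   atom_value n s t = atom_value n s' t' %[mod d])%Z.
Proof. by move=> ss tt; apply: meval_congr => -[[|[|//]] i]; rewrite !(tnth_nth 0). Qed.

End AtomValue.

From mathcomp Require Import constructive_ereal.
Import Order.TTheory GRing.Theory Num.Theory AtomValue.
Local Open Scope ereal_scope.

Lemma valuation_pexpM (p k : nat) (x : int) : prime p ->
  valuation p (p%:Z ^+ k * x)%R = k%:Z%:E + valuation p x.
Proof.
move=> pp; rewrite /valuation mulf_eq0 expf_eq0 eqz_nat (gtn_eqF (prime_gt0 pp)) andbF /=.
(* For [x = 0] both sides are [+oo]. *)
case: eqP => // /eqP x0; rewrite abszM abszX lognM ?expn_gt0 ?(prime_gt0 pp) ?absz_gt0 //.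
by rewrite lognX (logn_prime p pp) eqxx muln1.
Qed.

Lemma valuation_unit (p : nat) (x : int) : ~~ (p%:Z %| x)%Z -> valuation p x = 0%:E.
Proof.
rewrite /valuation; case: eqP => [->|_]; first by rewrite dvdz0.
move=> px; congr (Posz _)%:E; apply/eqP; rewrite eqn0Ngt logn_gt0 mem_primes !negb_and.
by rewrite dvdzE in px; rewrite px !orbT.
Qed.

Theorem theorem16 (s t : int) (p : nat) (s' t' : int) (a : nat) (b : \bar int) :
  prime p ->
  (0 < a)%N -> 0 < b -> (2 * a)%N%:Z%:E <= b ->
  ~~ (p%:Z %| (s' * t')%R)%Z ->
  s = (p%:Z ^+ a * s')%R ->
  t = (epow p b * t')%R ->
  forall n : nat, (2 <= n)%N ->
    ((2 * a)%N%:Z%:E < b ->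
       valuation p (lucas_atom n s t) = (totient n * a)%N%:Z%:E) /\
    (b = (2 * a)%N%:Z%:E ->
       valuation p (lucas_atom n s t) =
         (totient n * a)%N%:Z%:E + valuation p (lucas_atom n s' t')).
Proof.
move=> pp a0 b0 _ pst -> -> n n1.
have scale y : valuation p (lucas_atom n (p%:Z ^+ a * s')%R ((p%:Z ^+ a) ^+ 2 * y)%R) =
    (totient n * a)%N%:Z%:E + valuation p (lucas_atom n s' y).
  by rewrite atom_value_scale // -exprM mulnC valuation_pexpM.
split=> [ab|->]; last first.
  by rewrite -scale /= mulnC exprM.
(* Since b > 2a, at least one factor [p] is left over after [(p^a)^2] is taken out; it makes the
   second argument vanish modulo [p]. *)
have [y yE] : exists y, epow p b = ((p%:Z ^+ a) ^+ 2 * (p%:Z * y))%R.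
  case: b ab b0 => [[m|m]| |] //; rewrite ?lte_fin => ab _; last first.
    (* For b = [+oo], [epow] is 0, so [y = 0] serves. *)
    by exists 0%R; rewrite !mulr0.
  exists (p%:Z ^+ (m - (2 * a).+1))%R.
  by rewrite /= -exprS -exprM -exprD; congr (_ ^+ _)%R; rewrite mulnC addnS -addSn subnKC.
rewrite yE -mulrA scale valuation_unit ?adde0 //.
(* If [p] divided the remaining atom value, it would divide the value at [(s', 0)], a power of [s'],
   hence [s'] itself. *)
apply: contra pst => /dvdz_mod0P.
rewrite (atom_value_congr _ p%:Z _ _ s' 0%R) ?mod0z -?mulrA ?[(p%:Z * _)%R]mulrC ?modzMl //.
rewrite atom_value_s0 // => /dvdz_mod0P.
rewrite !dvdzE abszX Euclid_dvdX // => /andP[ps _].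
by rewrite abszM dvdn_mulr.
Qed.
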